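(* Let $n\ge 4$ be an integer and let $G$ be the graph which is the disjoint union of a loop $e$ and the complete graph $K_n$. For every spatial embedding $f$ of $G$ into the $3$-sphere, the following holds: $$\sum_{\gamma\in\Gamma_{n}(K_{n})}{\rm lk}(f(e),f(\gamma))^2=\sum_{\gamma\in\Gamma_{n-1}(K_{n})}{\rm lk}(f(e),f(\gamma))^2.$$
   Context: $K_n$ is the complete graph on $n$ vertices (each pair of distinct vertices is joined by exactly one edge). A loop $e$ is regarded as a graph homeomorphic to the circle (one vertex with one edge from it to itself). A spatial embedding $f$ of a finite graph $G$ is an embedding of $G$ into the $3$-sphere $S^3$; its image $f(G)$ is called a spatial graph of $G$. A cycle of a graph is a subgraph homeomorphic to the circle, and a $p$-cycle is a cycle containing exactly $p$ vertices. $\Gamma_p(K_n)$ denotes the set of all $p$-cycles of $K_n$ (as subgraphs, unoriented). ${\rm lk}(f(e),f(\gamma))\in\mathbb{Z}$ denotes the linking number of the disjoint knots $f(e)$ and $f(\gamma)$, computed with arbitrarily chosen orientations; its square does not depend on this choice. *)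

(* Defs.v *)
From HB Require Import structures.
From mathcomp Require Import all_boot all_order all_algebra.
From mathcomp Require Import all_classical all_reals all_analysis.
From mathcomp Require Import freeg.
From mathcomp Require Import zify ring lra.

Set Implicit Arguments.
Unset Strict Implicit.
Unset Printing Implicit Defensive.

Import Order.TTheory GRing.Theory Num.Theory.
Import numFieldNormedType.Exports.

Local Open Scope classical_set_scope.
Local Open Scope ring_scope.

Definition embedding (X Y : topologicalType) (f : X -> Y) : Prop :=
  injective f /\
  forall U : set X, open U <-> exists2 V : set Y, open V & U = f @^-1` V.

Definition sphere_set (R : realType) (d : nat) : set 'rV[R]_d.+1 :=
  [set x | \sum_i x 0 i ^+ 2 = 1].

(* [sphere R d] carries the subspace topology of [R^(d+1)]; the norm of ['rV]
   in the library is the sup norm, which induces the usual topology. *)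
Definition sphere (R : realType) (d : nat) : topologicalType :=
  set_type (@sphere_set R d).

(* The standard simplex with vertex set ['I_m] (of dimension [m - 1]). *)
Definition simplex_set (R : realType) (m : nat) : set 'rV[R]_m :=
  [set x | (forall i, 0 <= x 0 i) /\ \sum_i x 0 i = 1].

Definition simplex (R : realType) (m : nat) : topologicalType :=
  set_type (@simplex_set R m).

Definition face_fun (R : realType) (m : nat) (i : 'I_m.+1) (x : 'rV[R]_m) :
    'rV[R]_m.+1 :=
  \row_j oapp (x 0) 0 (unlift i j).

Lemma face_subproof (R : realType) (m : nat) (i : 'I_m.+1) (x : simplex R m) :
  face_fun i (val x) \in @simplex_set R m.+1.
Proof.
have /set_mem[x0 x1] := valP x; apply/mem_set; split=> [j|].
  by rewrite mxE; case: unliftP => [k _|_] //=; exact: x0.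
rewrite (bigD1_ord i) //= mxE unlift_none add0r -[RHS]x1.
by apply: eq_bigr => k _; rewrite mxE liftK.
Qed.

Definition face (R : realType) (m : nat) (i : 'I_m.+1) (x : simplex R m) :
    simplex R m.+1 :=
  exist _ (face_fun i (val x)) (face_subproof i x).

Section Homology.
Context (R : realType) (T : topologicalType).

(* Formal integral combinations of all maps from the [k]-simplex to [T],
   continuous or not: [chain_in] selects the singular chains of a subspace. *)
Definition chain (k : nat) := {freeg (simplex R k.+1 -> T)}.

Definition boundary (k : nat) : chain k.+1 -> chain k :=
  fglift (fun s : simplex R k.+2 -> T =>
    \sum_(i < k.+2) (-1) ^+ i *: (<< s \o @face R k.+1 i >> : chain k)).

Definition chain_in (A : set T) (k : nat) (z : chain k) : Prop :=
  forall s, s \in dom z -> continuous s /\ range s `<=` A.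

Definition cycle1 (A : set T) (z : chain 1) : Prop :=
  chain_in A z /\ boundary z = 0.

Definition boundary1 (A : set T) (z : chain 1) : Prop :=
  exists2 w : chain 2, chain_in A w & boundary w = z.

(* [phi], restricted to the 1-cycles of [A], induces a group isomorphism from
   [H_1(A; Z)] to [Z]. *)
Definition H1_iso_int (A : set T) (phi : chain 1 -> int) : Prop :=
  [/\ forall z w, cycle1 A z -> cycle1 A w -> phi (z + w) = phi z + phi w,
      forall z, cycle1 A z -> phi z = 0 <-> boundary1 A z
    & forall m, exists2 z, cycle1 A z & phi z = m].

End Homology.

(* The linking number of a knot [K] with a closed curve [c] disjoint from it is
   the class of [c] in [H_1(S^3 \ K) = Z] (Alexander duality).  The curve is
   parametrized by the 1-simplex, i.e. by [[0, 1]], and takes the same value at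
   both ends.  The isomorphism with [Z] is chosen arbitrarily, which amounts to
   an arbitrary choice of orientation of [K]; it exists for every subset [K]
   homeomorphic to a circle, so that the default value [fun=> 0] of [xget] is
   not used for knots. *)
Definition linking_number (R : realType) (K : set (sphere R 3))
    (c : simplex R 2 -> sphere R 3) : int :=
  xget (fun=> 0) [set phi | H1_iso_int (~` K) phi] (<< c >> : chain R _ 1).

Definition complete_rel (n : nat) : rel 'I_n := fun x y => x != y.

Definition cycle_edges (n : nat) (c : seq 'I_n) : {set {set 'I_n}} :=
  [set [set x; next c x] | x in c]%SET.

(* Running cyclically through [c] traverses, in one of its two directions, the
   cycle of [K_n] with edge set [g]. *)
Definition traverses (n : nat) (c : seq 'I_n) (g : {set {set 'I_n}}) : bool :=
  [&& (2 < size c)%N, ucycleb (@complete_rel n) c & cycle_edges c == g].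

(* A cycle has no isolated vertex, so it is determined by its edges. *)
Definition Gamma (p n : nat) : {set {set {set 'I_n}}} :=
  [set g | [exists c : p.-tuple 'I_n, traverses c g]]%SET.

Definition orientation (n : nat) (g : {set {set 'I_n}}) : seq 'I_n :=
  xget [::] [set c | traverses c g].

(* [K_n] is realized as the 1-skeleton of the simplex with vertex set ['I_n]. *)
Definition complete_set (R : realType) (n : nat) : set 'rV[R]_n :=
  @simplex_set R n `&` [set x | (#|[set i | x ord0 i != 0%R]%SET| <= 2)%N].

Definition complete_space (R : realType) (n : nat) : topologicalType :=
  set_type (@complete_set R n).

Definition component (R : realType) (n : nat) (b : bool) : topologicalType :=
  if b then complete_space R n else sphere R 1.

Definition loop_complete (R : realType) (n : nat) : topologicalType :=
  {b : bool & component R n b}.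

Definition in_loop (R : realType) (n : nat) (x : sphere R 1) :
    loop_complete R n :=
  existT (component R n) false x.

Definition in_complete (R : realType) (n : nat) (x : complete_space R n) :
    loop_complete R n :=
  existT (component R n) true x.

(* The walk of [K_n] through the vertices [x :: s] in this order, at constant
   speed: the vertex of index [k] is reached at time [k / size s]. *)
Definition walk_fun (R : realType) (n : nat) (x : 'I_n) (s : seq 'I_n) (t : R) :
    'rV[R]_n :=
  \sum_(k < (size s).+1)
    Num.max 0 (1 - `|(size s)%:R * t - k%:R|) *: delta_mx 0 (nth x (x :: s) k).


Lemma hat_sum (R : realType) (V : lmodType R) (m j : nat) (t : R)
    (e : nat -> V) :
  (j < m)%N -> 0 <= t - j%:R <= 1 ->
  \sum_(k < m.+1) Num.max 0 (1 - `|t - k%:R|) *: e k =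
    (1 - (t - j%:R)) *: e j + (t - j%:R) *: e j.+1.
Proof.
move=> jm /andP[t0 t1].
rewrite (bigD1 (Ordinal (ltnW jm : (j < m.+1)%N))) //=.
rewrite (bigD1 (Ordinal (jm : (j.+1 < m.+1)%N))) /=; last first.
  by rewrite -val_eqE /= (gtn_eqF (ltnSn j)).
rewrite big1 ?addr0 => [|k /andP[kj kj1]].
  rewrite (ger0_norm t0) -natr1 ler0_norm; last by lra.
  by congr (_ *: _ + _ *: _); rewrite max_r; lra.
rewrite max_l ?scale0r // subr_le0.
have [kj'|jk] : (k < j \/ j.+1 < k)%N.
  by move: kj kj1; rewrite -!val_eqE /= => /eqP ? /eqP ?; lia.
  have : (k.+1%:R : R) <= j%:R by rewrite ler_nat.
  by rewrite -natr1 => ?; rewrite ger0_norm; lra.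
have : (j.+2%:R : R) <= k%:R by rewrite ler_nat.
by rewrite -natr1 -natr1 => ?; rewrite ler0_norm; lra.
Qed.

Lemma edge_in_complete (R : realType) (n : nat) (x y : 'I_n) (a : R) :
  0 <= a <= 1 ->
  @complete_set R n ((1 - a) *: delta_mx 0 x + a *: delta_mx 0 y).
Proof.
move=> /andP[a0 a1]; split; first split.
- by move=> i; rewrite !mxE eqxx /= addr_ge0 // mulr_ge0 ?ler0n ?subr_ge0.
- under eq_bigr do rewrite !mxE eqxx /=.
  have delta_sum z : \sum_i ((i == z)%:R : R) = 1.
    by rewrite (bigD1 z) //= eqxx big1 ?addr0 // => i /negPf ->.
  by rewrite big_split /= -!mulr_sumr !delta_sum; lra.
rewrite /=; apply: (@leq_trans #|[set x; y]%SET|); last first.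
  by rewrite cards2; case: (_ != _).
apply: subset_leq_card; apply/fintype.subsetP => i; rewrite !inE !mxE eqxx /=.
by apply: contraR; rewrite negb_or => /andP[/negPf-> /negPf->]; rewrite !mulr0 addr0.
Qed.

Lemma walk_subproof (R : realType) (n : nat) (x : 'I_n) (s : seq 'I_n)
    (u : simplex R 2) :
  walk_fun x s (val u ord0 ord_max) \in @complete_set R n.
Proof.
have /set_mem[u0 u1] := valP u; apply/mem_set.
have {}u1 : val u ord0 ord_max <= 1.
  rewrite !big_ord_recl big_ord0 addr0 in u1.
  rewrite (_ : fintype.lift _ _ = ord_max) in u1; last exact: val_inj.
  by have := u0 ord0; lra.
have {u0} := u0 ord_max; move: (val u ord0 ord_max) u1 => t t1 t0.
rewrite /walk_fun; set m := size s.
have [m0|m_gt0] := posnP m.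
  rewrite m0 big_ord_recl big_ord0 addr0 mul0r subrr normr0 subr0.
  rewrite max_r // scale1r.
  have := @edge_in_complete R n x x 0; rewrite lexx ler01 => /(_ isT).
  by rewrite subr0 scale1r scale0r addr0.
have [j jm jt] : exists2 j, (j < m)%N & 0 <= m%:R * t - j%:R <= 1.
  have mt0 : 0 <= m%:R * t by rewrite mulr_ge0.
  have [jm|mj] := ltnP (Num.truncn (m%:R * t)) m.
    exists (Num.truncn (m%:R * t)) => //.
    by have := truncn_itv mt0; rewrite -natr1 => /andP[? ?]; lra.
  exists m.-1; first by rewrite prednK.
  have mt : m%:R * t <= m%:R by rewrite ler_piMr.
  have := truncn_itv mt0; have : (m%:R : R) <= (Num.truncn (m%:R * t))%:R.
    by rewrite ler_nat.
  have <- : (m.-1%:R + 1 : R) = m%:R by rewrite natr1 prednK.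
  move: mt; have <- : (m.-1%:R + 1 : R) = m%:R by rewrite natr1 prednK.
  by lra.
rewrite (hat_sum (fun k => delta_mx 0 (nth x (x :: s) k)) jm jt).
exact: edge_in_complete.
Qed.

Definition walk (R : realType) (n : nat) (x : 'I_n) (s : seq 'I_n)
    (u : simplex R 2) : complete_space R n :=
  exist _ (walk_fun x s (val u ord0 ord_max)) (walk_subproof x s u).

(* A set [g] that is not a cycle has empty [orientation], hence value [0]. *)
Definition lk (R : realType) (n : nat) (f : loop_complete R n -> sphere R 3)
    (g : {set {set 'I_n}}) : int :=
  if orientation g is x :: s then
    linking_number (range (f \o @in_loop R n))
      (f \o @in_complete R n \o walk x (rcons s x))
  else 0.

(* Main.v *)
From mathcomp Require Import fingroup perm.
Require Import Defs.
From mathcomp Require Import all_boot all_order all_algebra.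
From mathcomp Require Import all_classical all_reals all_analysis.
From mathcomp Require Import freeg zify ring lra.

Set Implicit Arguments.
Unset Strict Implicit.
Unset Printing Implicit Defensive.

Import Order.TTheory GRing.Theory Num.Theory.
Import numFieldNormedType.Exports.

Local Open Scope ring_scope.

(** Let [A] be the complement of the knot [K] that the loop spans.  If
    [H_1(A)] is not isomorphic to [Z], all linking numbers are [0] by
    definition.  Otherwise let [phi] be the isomorphism that defines them.

    Every closed walk of [K_n] is homologous in [A] to the sum of its edges.
    Coning each edge off from a base vertex [x0] turns the edges into
    triangles [x0 x y], which are cycles; the added spokes cancel around a
    closed walk.  So the linking number of a cycle [c] of [K_n] is the sum over
    the edges [xy] of [c] of an integer [w x y = phi (triangle x0 x y)], and
    [w x y = - w y x] ([class_closed_walk], [triangle_classC]).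

    What remains holds for every antisymmetric [w] ([sum_Gamma_eq]).  Average
    the square of the [w]-sum of a [p]-cycle over all permutations of the
    vertices and expand it into products indexed by pairs of edges.  Pairs of
    disjoint edges contribute [0], since exchanging the ends of one edge changes
    the sign; each edge contributes one diagonal term and two terms for its
    neighbours, whose averages depend neither on the edge nor on [p].  Hence the
    average is [p] times a constant [C] independent of [p].  There are [n ^_ p]
    sequences of [p] distinct vertices, and each [p]-cycle is traversed by [2p]
    of them, so the sum over the [p]-cycles is [C / 2] times [n ^_ p], which is
    [n!] both for [p = n] and for [p = n - 1]. *)

(** * Traversals of a cycle of the complete graph *)

Section Cycles.
Context (n : nat).
Implicit Types (c : seq 'I_n) (g : {set {set 'I_n}}).

Lemma next_next_neq c x : uniq c -> (2 < size c)%N -> x \in c ->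
  [/\ next c x != x, next c (next c x) != x & next c (next c x) != next c x].
Proof.
move=> Uc c2 xc; have [i s cE] := rot_to xc.
have : uniq (rot i c) by rewrite rot_uniq.
have : (2 < size (rot i c))%N by rewrite size_rot.
rewrite -!(next_rot i Uc) cE; case: s {cE} => [|y [|z s]] //= _.
rewrite eqxx !inE !negb_or => /andP[/and3P[xy xz _] /andP[/andP[yz _] _]].
by rewrite [y == x]eq_sym (negPf xy) eqxx ![z == _]eq_sym xz yz.
Qed.

Lemma next_neq_prev c x : uniq c -> (2 < size c)%N -> x \in c ->
  next c x != prev c x.
Proof.
move=> Uc c2 xc; have xc' : prev c x \in c by rewrite mem_prev.
by have [_ + _] := next_next_neq Uc c2 xc'; rewrite next_prev.
Qed.

Lemma traversesP c g :
  reflect [/\ (2 < size c)%N, uniq c & cycle_edges c = g] (traverses c g).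
Proof.
apply: (iffP and3P) => [[c2 /andP[_ Uc] /eqP]|[c2 Uc <-]]; split=> //.
apply/andP; split=> //; apply: cycle_from_next => // x xc.
by have [xn _ _] := next_next_neq Uc c2 xc; rewrite /complete_rel eq_sym.
Qed.

Lemma mem_cycle_edges c x y : uniq c -> (2 < size c)%N -> x \in c ->
  ([set x; y]%SET \in cycle_edges c) = (y == next c x) || (y == prev c x).
Proof.
move=> Uc c2 xc; apply/imsetP/orP => [[z zc]|[/eqP->|/eqP->]]; first last.
- exists (prev c x); first by rewrite mem_prev.
  by rewrite next_prev // finset.setUC.
- by exists x.
move=> /setP E; have [zn _ _] := next_next_neq Uc c2 zc.
have := E (next c z); have := E z; have := E x; rewrite !inE !eqxx ?orbT /=.
move=> {E} /esym /orP[/eqP xz|/eqP xz].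
  by move=> _; rewrite xz (negPf zn) orFb eq_sym => /esym; left.
rewrite xz [z == next c z]eq_sym (negPf zn) orFb => /eqP <- _; right.
by rewrite prev_next.
Qed.

Lemma cover_cycle_edges c : finset.cover (cycle_edges c) =i c.
Proof.
move=> x; apply/bigcupP/idP => [[e /imsetP[z zc ->]]|xc].
  by rewrite !inE => /orP[] /eqP-> //; rewrite mem_next.
by exists [set x; next c x]%SET; [exact: imset_f | rewrite !inE eqxx].
Qed.

Lemma traverses_mem c c' g : traverses c g -> traverses c' g -> c =i c'.
Proof.
move=> /traversesP[_ _ cE] /traversesP[_ _ cE'] x.
by rewrite -cover_cycle_edges cE -cE' cover_cycle_edges.
Qed.

Lemma traverses_rot i c g : traverses c g -> traverses (rot i c) g.
Proof.
move=> /traversesP[c2 Uc <-]; apply/traversesP; split.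
- by rewrite size_rot.
- by rewrite rot_uniq.
apply/setP => e; apply/imsetP/imsetP => -[x xc ->]; exists x => //.
- by rewrite mem_rot in xc.
- by rewrite next_rot.
- by rewrite mem_rot.
- by rewrite next_rot.
Qed.

Lemma traverses_rev c g : traverses c g -> traverses (rev c) g.
Proof.
move=> /traversesP[c2 Uc <-]; apply/traversesP; split.
- by rewrite size_rev.
- by rewrite rev_uniq.
apply/setP => e; apply/imsetP/imsetP => -[x].
- rewrite mem_rev => xc ->; exists (prev c x); rewrite ?mem_prev //.
  by rewrite next_rev // next_prev // finset.setUC.
- move=> xc ->; exists (next c x); rewrite ?mem_rev ?mem_next //.
  by rewrite next_rev // prev_next // finset.setUC.
Qed.

(** A vertex of a cycle has only two neighbours, so once two traversals pass
    through an edge in the same direction the next step is forced on both. *)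
Lemma next_spread c c' g x : traverses c g -> traverses c' g -> x \in c' ->
  next c' x = next c x -> {in c', next c' =1 next c}.
Proof.
move=> tc tc' xc' xE y yc'; have cc' := traverses_mem tc tc'.
have /traversesP[c2 Uc cE] := tc; have /traversesP[c'2 Uc' cE'] := tc'.
rewrite -(fconnect_cycle (cycle_next Uc') xc') in yc'.
have <- := iter_findex yc'; elim: (findex _ _ _) => //= k.
have : iter k (next c') x \in c' by elim: k => //= k; rewrite mem_next.
move: (iter k _ _) => {yc'}y yc' yE; have zc' : next c' y \in c' by rewrite mem_next.
have : [set next c' y; next c' (next c' y)]%SET \in g.
  by rewrite -cE' mem_cycle_edges // eqxx.
rewrite -cE mem_cycle_edges ?cc' // => /orP[] /eqP // zE.
have [_ + _] := next_next_neq Uc' c'2 yc'.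
by rewrite zE [in X in prev c X]yE prev_next // eqxx.
Qed.

(** The first step of [c'] leads to one of the two neighbours in [c] of its
    starting point; [next_spread] propagates this choice of a direction. *)
Lemma traverses_next c c' g : traverses c g -> traverses c' g ->
  {in c', next c' =1 next c} \/ {in c', next c' =1 next (rev c)}.
Proof.
move=> tc tc'; have cc' := traverses_mem tc tc'.
have /traversesP[c2 Uc cE] := tc; have /traversesP[c'2 Uc' cE'] := tc'.
have [x xc'] : exists x, x \in c'.
  by case: c' c'2 {tc' cc' cE' Uc'} => // x s _; exists x; rewrite inE eqxx.
have : [set x; next c' x]%SET \in g by rewrite -cE' mem_cycle_edges // eqxx.
rewrite -cE mem_cycle_edges ?cc' // -next_rev // => /orP[] /eqP; [left|right].
  exact: next_spread tc tc' xc' _.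
exact: next_spread (traverses_rev tc) tc' xc' _.
Qed.

Lemma next_inj_rot c c' : (0 < size c')%N -> uniq c -> uniq c' -> c =i c' ->
  {in c', next c' =1 next c} -> exists2 i, (i < size c)%N & c' = rot i c.
Proof.
case: c' => [|x s'] // _ Uc Uc' cc' E.
have xc : x \in c by rewrite cc' inE eqxx.
exists (index x c); first by rewrite index_mem.
have cE := rot_index xc; set s := _ ++ _ in cE; rewrite cE; congr cons.
have Us : uniq (x :: s) by rewrite -cE rot_uniq.
have fs : fcycle (next c) (x :: s) by rewrite -cE rot_cycle cycle_next.
have fs' : fcycle (next c) (x :: s').
  have E2 : {in [in x :: s'] &, frel (next (x :: s')) =2 frel (next c)}.
    by move=> y z ys' _; exact: (congr1 (eq_op^~ z) (E y ys')).
  by rewrite -(eq_in_cycle E2) ?cycle_next //; apply/allP.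
have sizes : size s = size s'.
  have /perm_size : perm_eq (x :: s) (x :: s'); last by move=> /= [].
  by apply: uniq_perm => // y; rewrite -cE mem_rot cc'.
move: fs fs' => /= /fpathP[k sE] /fpathP[k' sE'].
have kk' : k = k'.
  have := congr1 size sE; have := congr1 size sE'.
  by rewrite !size_rcons !size_traject sizes => <-.
by move: sE'; rewrite -kk' -sE => /rcons_inj[].
Qed.

(** The traversals are the [p] rotations of one of them and the [p] rotations of
    its reverse; these two families are disjoint because [2 < p]. *)
Lemma card_traversals p g : g \in Gamma p n ->
  #|[set t : p.-tuple 'I_n | traverses t g]%SET| = p.*2.
Proof.
rewrite inE => /existsP[c tc]; have /traversesP[c2 Uc cE] := tc.
pose F (ib : 'I_p * bool) := [tuple of rot ib.1 (if ib.2 then rev_tuple c else c)].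
have -> : [set t : p.-tuple 'I_n | traverses t g]%SET =
    [set F ib | ib : 'I_p * bool]%SET.
  apply/setP => t; rewrite inE; apply/idP/imsetP => [tt|[[i b] _ ->]]; last first.
    by apply: traverses_rot; case: b => //=; exact: traverses_rev.
  have /traversesP[t2 Ut _] := tt; have ct := traverses_mem tc tt.
  have [E|E] := traverses_next tc tt.
    have [i ip tE] := next_inj_rot (ltnW (ltnW t2)) Uc Ut ct E.
    rewrite size_tuple in ip.
    by exists (Ordinal ip, false) => //; exact: val_inj.
  have /traversesP[_ Uc' _] := traverses_rev tc.
  have rct : rev c =i t by move=> y; rewrite mem_rev.
  have [i ip tE] := next_inj_rot (ltnW (ltnW t2)) Uc' Ut rct E.
  rewrite size_rev size_tuple in ip.
  by exists (Ordinal ip, true) => //; exact: val_inj.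
rewrite card_imset ?card_prod ?card_ord ?card_bool ?muln2 //.
move=> [i b] [j b'] /(congr1 val) /= E.
have bb : b = b'.
  have [x xc] : exists x, x \in tval c.
    by case: (tval c) c2 => // x s _; exists x; rewrite inE eqxx.
  have := congr1 (fun s => next s x) E.
  have := next_neq_prev Uc c2 xc.
  case: b b' {E} => [] [] //=; rewrite !next_rot ?rev_uniq ?next_rev //.
    by move=> /eqP + /esym.
  by move=> /eqP.
move: E; rewrite -{}bb; set d := if b then _ else _ => E; congr pair.
have Ud : uniq d by rewrite /d; case: b {d E} => //=; rewrite rev_uniq.
have sd : size d = p by rewrite size_tuple.
have [x0 _] : exists x, x \in tval c.
  by case: (tval c) c2 => // x s _; exists x; rewrite inE eqxx.
have hd k : (k < p)%N -> index (head x0 (rot k d)) d = k.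
  move=> kp; rewrite -nth0 nth_cat size_drop sd subn_gt0 kp.
  by rewrite nth_drop addn0 index_uniq ?sd.
by apply: val_inj; rewrite /= -(hd i) // E hd.
Qed.

Context (w : 'I_n -> 'I_n -> int).
Context (wC : forall x y, w x y = - w y x).

Definition cycle_sum c := \sum_(x <- c) w x (next c x).

(** Reversing the direction only changes the sign of the sum. *)
Lemma cycle_sum_traverses c c' g : traverses c g -> traverses c' g ->
  cycle_sum c' ^+ 2 = cycle_sum c ^+ 2.
Proof.
move=> tc tc'; have cc' := traverses_mem tc tc'.
have /traversesP[c2 Uc cE] := tc; have /traversesP[_ Uc' _] := tc'.
have pc : perm_eq c' c by apply: uniq_perm => // y; rewrite cc'.
rewrite /cycle_sum; have [E|E] := traverses_next tc tc'.
  rewrite (perm_big _ pc) /=; congr (_ ^+ 2); apply: eq_big_seq => x xc.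
  by rewrite E // -cc'.
rewrite (perm_big _ pc) /=.
have nc : perm_eq (map (next c) c) c.
  apply: uniq_perm => //.
    by rewrite map_inj_uniq //; apply: can_inj (prev_next Uc).
  move=> y; apply/mapP/idP => [[x xc ->]|yc]; first by rewrite mem_next.
  by exists (prev c y); rewrite ?mem_prev ?next_prev.
rewrite -(perm_big _ nc) /= big_map -sqrrN -sumrN; congr (_ ^+ 2).
apply: eq_big_seq => x xc.
by rewrite E -?cc' ?mem_next // next_rev // prev_next // -wC.
Qed.

(** * Averaging over the permutations of the vertices *)

(** Up to a factor [n!], the correlation of the values of [w] on the edges [ij]
    and [kl] under a random relabelling of the vertices. *)
Definition perm_corr (i j k l : 'I_n) : int :=
  \sum_(s : {perm 'I_n}) w (s i) (s j) * w (s k) (s l).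

Lemma perm_corr_perm (t : {perm 'I_n}) i j k l :
  perm_corr (t i) (t j) (t k) (t l) = perm_corr i j k l.
Proof.
rewrite /perm_corr [RHS](reindex_inj (mulgI t)) /=.
by apply: eq_bigr => s _; rewrite !permM.
Qed.

(** Exchanging [k] and [l] preserves the sum and negates every term. *)
Lemma perm_corr_disjoint i j k l : k \notin [:: i; j] -> l \notin [:: i; j] ->
  perm_corr i j k l = 0.
Proof.
move=> kij lij; suff : perm_corr i j k l = - perm_corr i j k l by lia.
rewrite -{1}(perm_corr_perm (tperm k l)) tpermL tpermR.
move: kij lij; rewrite !inE !negb_or => /andP[ki kj] /andP[li lj].
rewrite !tpermD // /perm_corr -sumrN; apply: eq_bigr => s _.
by rewrite [in LHS](wC (s l)) mulrN.
Qed.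

(** Permutations act transitively on sequences of distinct points: the one that
    matches the tails is corrected by a transposition that fixes them. *)
Lemma uniq_perm_ext (a b : seq 'I_n) : uniq a -> uniq b -> size a = size b ->
  exists s : {perm 'I_n}, map s a = b.
Proof.
elim: a b => [|x a IH] [|y b] //= => [_ _ _|]; first by exists 1%g.
move=> /andP[xa Ua] /andP[yb Ub] [ab]; have [s sE] := IH b Ua Ub ab.
exists (s * tperm (s x) y)%g; rewrite permM tpermL; congr cons.
rewrite -sE; apply/eq_in_map => z za; rewrite permM tpermD //.
  by apply: contra xa => /eqP/perm_inj->.
by apply: contra yb => /eqP->; rewrite -sE map_f.
Qed.

Context (i0 j0 k0 : 'I_n) (ijk : uniq [:: i0; j0; k0]).

(** Up to a factor [n!], the share of one edge [xy] in the expected square of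
    the [w]-sum of a cycle: the product of [w x y] with itself and with the two
    neighbouring edges.  Any triple of distinct vertices gives the same value. *)
Definition perm_mean := perm_corr i0 j0 i0 j0 + perm_corr i0 j0 j0 k0 *+ 2.

Lemma perm_corr_transport i j k : uniq [:: i; j; k] ->
  perm_corr i j i j = perm_corr i0 j0 i0 j0 /\
  perm_corr i j j k = perm_corr i0 j0 j0 k0.
Proof.
move=> U; have [s [<- <- <-]] := uniq_perm_ext ijk U erefl.
by rewrite !perm_corr_perm.
Qed.

Lemma cycle_sum_map (s : {perm 'I_n}) c : uniq c ->
  cycle_sum (map s c) = \sum_(x <- c) w (s x) (s (next c x)).
Proof.
move=> Uc; rewrite /cycle_sum big_map.
by under eq_bigr do rewrite (next_map perm_inj Uc).
Qed.

Lemma sum_perm_cycle_sum c : uniq c -> (2 < size c)%N ->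
  \sum_(s : {perm 'I_n}) cycle_sum (map s c) ^+ 2 = perm_mean *+ size c.
Proof.
move=> Uc c2; under eq_bigr do rewrite cycle_sum_map // expr2 mulr_suml.
rewrite exchange_big /= -iter_addr_0 -(count_predT c) -big_const_seq.
apply: eq_big_seq => x xc; under eq_bigr do rewrite mulr_sumr.
rewrite exchange_big -/(perm_corr x (next c x) _ _) /=.
rewrite -[LHS]/(\sum_(y <- c) perm_corr x (next c x) y (next c y)).
have xn : next c x \in c by rewrite mem_next.
have xp : prev c x \in c by rewrite mem_prev.
have [h1 h2 h3] := next_next_neq Uc c2 xc.
have [k1 k2 k3] := next_next_neq Uc c2 xp.
have h4 := next_neq_prev Uc c2 xc.
rewrite next_prev // in k1 k2 k3.
have [aE bE] : perm_corr x (next c x) x (next c x) = perm_corr i0 j0 i0 j0 /\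
  perm_corr x (next c x) (next c x) (next c (next c x)) = perm_corr i0 j0 j0 k0.
  by apply: perm_corr_transport; rewrite /= !inE negb_or !(eq_sym x) h1 h2 eq_sym h3.
have [_ cE] : perm_corr (prev c x) x (prev c x) x = perm_corr i0 j0 i0 j0 /\
  perm_corr (prev c x) x x (next c x) = perm_corr i0 j0 j0 k0.
  apply: perm_corr_transport.
  by rewrite /= !inE negb_or !(eq_sym (prev c x)) k1 k2 eq_sym k3.
(* The edge at [y] meets the edge at [x] for [y = x], [next c x], [prev c x]. *)
rewrite big_uniq //= (bigD1 x) //= (bigD1 (next c x)) ?xn //=.
rewrite (bigD1 (prev c x)) /=; last by rewrite xp eq_sym k1 eq_sym h4.
rewrite big1 ?addr0 => [|y /andP[/andP[/andP[yc yx] yn] yp]].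
  rewrite aE bE next_prev // /perm_mean mulr2n; congr (_ + (_ + _)); rewrite -cE.
  by apply: eq_bigr => s _; rewrite mulrC.
apply: perm_corr_disjoint; rewrite !inE negb_or ?yx //.
apply/andP; split; last by apply: contra yx => /eqP/(can_inj (prev_next Uc))->.
by apply: contra yp => /eqP <-; rewrite prev_next.
Qed.

(** Double counting: a permutation of the vertices permutes the sequences of
    distinct vertices, so averaging over permutations does not change the sum. *)
Lemma sum_uniq_tuples p : (2 < p)%N ->
  (\sum_(t : p.-tuple 'I_n | uniq t) cycle_sum t ^+ 2) *+ n`! =
  perm_mean *+ (n ^_ p * p).
Proof.
move=> p2.
have : \sum_(t : p.-tuple 'I_n | uniq t) \sum_(s : {perm 'I_n}) cycle_sum (map s t) ^+ 2
  = perm_mean *+ (n ^_ p * p).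
  transitivity (\sum_(t : p.-tuple 'I_n | uniq t) perm_mean *+ p).
    by apply: eq_bigr => t Ut; rewrite sum_perm_cycle_sum ?size_tuple.
  rewrite sumr_const -mulrnA mulnC -[in n ^_ _](card_ord n) -card_uniq_tuples.
  by congr (_ *+ (_ * _)); apply: eq_card => t; rewrite !inE all_predT.
move=> <-; rewrite exchange_big /=.
transitivity (\sum_(s : {perm 'I_n})
    \sum_(t : p.-tuple 'I_n | uniq t) cycle_sum t ^+ 2).
  by rewrite sumr_const card_Sn.
apply: eq_bigr => s _; rewrite (reindex (fun t : p.-tuple 'I_n => map_tuple s t)) /=.
  by apply: eq_bigl => t; rewrite map_inj_uniq //; exact: perm_inj.
exists (fun t => map_tuple (s^-1)%g t) => t _; apply: val_inj; rewrite /= -map_comp.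
  by rewrite map_id_in // => x _ /=; rewrite permK.
by rewrite map_id_in // => x _ /=; rewrite permKV.
Qed.

(** Each cycle is counted [2p] times in the sum over sequences. *)
Lemma sum_Gamma p (F : {set {set 'I_n}} -> int) : (2 < p)%N ->
  (forall c g, traverses c g -> F g ^+ 2 = cycle_sum c ^+ 2) ->
  (\sum_(g in Gamma p n) F g ^+ 2) *+ (n`! * 2) = perm_mean *+ n ^_ p.
Proof.
move=> p2 FE.
have tuplesE : \sum_(t : p.-tuple 'I_n | uniq t) cycle_sum t ^+ 2 =
    (\sum_(g in Gamma p n) F g ^+ 2) *+ p.*2.
  rewrite (partition_big (fun t : p.-tuple 'I_n => cycle_edges t) (mem (Gamma p n))) /=.
    rewrite -sumrMnl; apply: eq_bigr => g /card_traversals <-; rewrite -sumr_const.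
    apply: congr_big => // t.
      rewrite inE; apply/andP/traversesP => [[Ut /eqP tg]|[_ Ut /eqP tg]] //.
      by split=> //; rewrite size_tuple.
    move=> /andP[Ut /eqP tg]; apply/esym/FE/traversesP; split=> //.
    by rewrite size_tuple.
  move=> t Ut; rewrite inE; apply/existsP; exists t; apply/traversesP.
  by split=> //; rewrite size_tuple.
have p0 : (0 < p)%N by exact: leq_trans p2.
apply: (pmulrnI p0); rewrite -!mulrnA -sum_uniq_tuples // tuplesE -mulrnA.
by congr (_ *+ _); rewrite -muln2 mulnC -mulnA [(2 * _)%N]mulnC.
Qed.

End Cycles.

Lemma sum_Gamma_eq n (w : 'I_n -> 'I_n -> int) (F : {set {set 'I_n}} -> int) :
  (3 < n)%N -> (forall x y, w x y = - w y x) ->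
  (forall c g, traverses c g -> F g ^+ 2 = cycle_sum w c ^+ 2) ->
  \sum_(g in Gamma n n) F g ^+ 2 = \sum_(g in Gamma n.-1 n) F g ^+ 2.
Proof.
case: n w F => [|[|[|[|n]]]] // w F _ wC FE.
pose o i : 'I_n.+4 := inord i.
have U : uniq [:: o 0; o 1; o 2].
  by rewrite /= !inE -!val_eqE /= !inordK.
have fact_gt0 : (0 < n.+4`! * 2)%N by rewrite muln_gt0 fact_gt0.
apply: (pmulrnI fact_gt0).
have -> := @sum_Gamma _ w wC _ _ _ U n.+4 F isT FE.
have -> := @sum_Gamma _ w wC _ _ _ U n.+3 F isT FE.
by rewrite (ffactnSr _ n.+3) subSnn muln1.
Qed.

(** * Singular chains along a path *)

Section Chains.
Context (R : realType) (T : topologicalType).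
Local Open Scope classical_set_scope.

Lemma chain_in_simplex (A : set T) k (s : simplex R k.+1 -> T) :
  continuous s -> range s `<=` A -> chain_in A (<< s >> : chain R T k).
Proof. by move=> sc sA s'; rewrite domU1 inE => /eqP->. Qed.

Lemma chain_inB (A : set T) k (z w : chain R T k) :
  chain_in A z -> chain_in A w -> chain_in A (z - w).
Proof.
by move=> zA wA s /domB; rewrite mem_cat => /orP[]; [exact: zA|exact: wA].
Qed.

Lemma chain_inD (A : set T) k (z w : chain R T k) :
  chain_in A z -> chain_in A w -> chain_in A (z + w).
Proof.
by move=> zA wA s /domD_subset; rewrite mem_cat => /orP[]; [exact: zA|exact: wA].
Qed.

Lemma chain_in0 (A : set T) k : chain_in A (0 : chain R T k).
Proof. by move=> s; rewrite dom0. Qed.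

Lemma boundaryB k : {morph @boundary R T k : z w / z - w}.
Proof. exact: lift_is_additive. Qed.

Lemma boundary0 k : @boundary R T k 0 = 0.
Proof. by rewrite -[X in boundary X](subrr 0) boundaryB subrr. Qed.

Lemma boundaryD k : {morph @boundary R T k : z w / z + w}.
Proof.
by move=> z w; rewrite -[in LHS](opprK w) -[- w]sub0r !boundaryB boundary0 sub0r opprK.
Qed.

Lemma boundaryU k (s : simplex R k.+2 -> T) :
  boundary (<< s >> : chain R T k.+1) =
    \sum_(i < k.+2) (-1) ^+ i *: (<< s \o @face R k.+1 i >> : chain R T k).
Proof. by rewrite /boundary liftU scale1r. Qed.

(** The singular simplex that maps affinely to the line, with vertices [v], and
    then along the path [P].  Every homology needed between pieces of a path is
    bounded by such simplices, without any reparametrization. *)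
Definition affine_simplex (P : R -> T) k (v : seq R) (u : simplex R k) : T :=
  P (\sum_j val u ord0 j * v`_j).

Lemma affine_simplex_face (P : R -> T) k (v v' : seq R) (i : 'I_k.+1) :
  (forall j : 'I_k, v'`_j = v`_(bump i j)) ->
  affine_simplex P v \o @face R k i = affine_simplex P v'.
Proof.
move=> vE; apply/funext => u /=; rewrite /affine_simplex (bigD1_ord i) //=.
rewrite mxE unlift_none mul0r add0r; congr P; apply: eq_bigr => j _.
by rewrite mxE liftK vE.
Qed.

Definition segment (P : R -> T) (a b : R) : chain R T 1 :=
  << @affine_simplex P 2 [:: a; b] >>.

Lemma boundary_triangle (P : R -> T) (a b c : R) :
  boundary (<< @affine_simplex P 3 [:: a; b; c] >> : chain R T 2) =
    segment P b c - segment P a c + segment P a b.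
Proof.
rewrite boundaryU !big_ord_recl big_ord0 addr0 addrA.
rewrite expr0 scale1r expr1 scaleN1r expr2 mulrN1 opprK scale1r.
rewrite /segment; congr (<< _ >> - << _ >> + << _ >>).
all: by apply: affine_simplex_face => -[[|[|[]]]].
Qed.

Lemma boundary_segment (P : R -> T) (a b : R) :
  boundary (segment P a b) =
    << @affine_simplex P 1 [:: b] >> - << @affine_simplex P 1 [:: a] >>.
Proof.
rewrite boundaryU !big_ord_recl big_ord0 addr0.
rewrite expr0 scale1r expr1 scaleN1r; congr (<< _ >> - << _ >>).
all: by apply: affine_simplex_face => -[[|[|[]]]].
Qed.

Lemma val_continuous (V : topologicalType) (X : set V) :
  continuous (val : set_type X -> V).
Proof. exact: initial_continuous. Qed.

Lemma simplex_coord_continuous k (j : 'I_k) :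
  continuous (fun u : simplex R k => val u ord0 j).
Proof.
move=> u; have vc := @val_continuous _ (@simplex_set R k) u.
have cc := @coord_continuous R 1 k ord0 j (val u).
exact: (@continuous_comp _ _ _ _ (fun x : 'rV[R]_k => x ord0 j) _ vc cc).
Qed.

Lemma affine_simplex_continuous (P : R -> T) k (v : seq R) :
  continuous P -> continuous (@affine_simplex P k v).
Proof.
move=> Pc; suff lc : continuous (fun u : simplex R k => \sum_j val u ord0 j * v`_j).
  by move=> u; apply: continuous_comp; [exact: lc | exact: Pc].
apply: continuous_big => [|j _ u]; first exact: add_continuous.
by apply: cvgMr_tmp; [exact: nbhs_filter | exact: simplex_coord_continuous].
Qed.

Definition homologous (A : set T) (z w : chain R T 1) := boundary1 A (z - w).

Lemma homologous_refl A z : homologous A z z.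
Proof. by exists 0; [exact: chain_in0 | rewrite boundary0 subrr]. Qed.

Lemma homologousD A z w z' w' :
  homologous A z w -> homologous A z' w' -> homologous A (z + z') (w + w').
Proof.
move=> [x xA xE] [y yA yE]; exists (x + y); first exact: chain_inD.
by rewrite boundaryD xE yE opprD addrACA.
Qed.

Lemma homologous_trans A w z x :
  homologous A z w -> homologous A w x -> homologous A z x.
Proof.
by move=> h1 h2; have := homologousD h1 h2; rewrite /homologous addrKA.
Qed.

Section Path.
Context (A : set T) (P : R -> T) (Pc : continuous P) (PA : range P `<=` A).

Lemma affine_simplex_chain_in k (v : seq R) :
  chain_in A (<< @affine_simplex P k.+1 v >> : chain R T k).
Proof.
apply: chain_in_simplex; first exact: affine_simplex_continuous.
by move=> _ [u _ <-]; apply: PA; exists (\sum_j val u ord0 j * v`_j).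
Qed.

Lemma segment_split a b c :
  homologous A (segment P a b + segment P b c) (segment P a c).
Proof.
exists << @affine_simplex P 3 [:: a; b; c] >>; first exact: affine_simplex_chain_in.
by rewrite boundary_triangle addrAC [segment P b c + _]addrC.
Qed.

Lemma segment_point a : homologous A (segment P a a) 0.
Proof.
exists << @affine_simplex P 3 [:: a; a; a] >>; first exact: affine_simplex_chain_in.
by rewrite boundary_triangle subrr add0r subr0.
Qed.

Lemma segment_sum (t : nat -> R) m :
  homologous A (\sum_(k < m) segment P (t k) (t k.+1)) (segment P (t 0%N) (t m)) .
Proof.
elim: m => [|m IH].
  rewrite big_ord0; have [x xA xE] := segment_point (t 0%N).
  exists (- x); first by rewrite -sub0r; apply: chain_inB => //; exact: chain_in0.
  by rewrite -sub0r boundaryB boundary0 xE !sub0r subr0.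
rewrite big_ord_recr /=; apply: homologous_trans (segment_split _ (t m) _).
by apply: homologousD => //; exact: homologous_refl.
Qed.

End Path.

(** * The isomorphism with the integers *)

(** The isomorphism says nothing about chains that are not cycles; this is why
    edges are replaced by triangles before it is applied. *)
Section Class.
Context (A : set T) (phi : chain R T 1 -> int) (phi_iso : H1_iso_int A phi).
Implicit Types z w : chain R T 1.

Lemma cycle1D z w : cycle1 A z -> cycle1 A w -> cycle1 A (z + w).
Proof.
move=> [zA z0] [wA w0]; split; first exact: chain_inD.
by rewrite boundaryD z0 w0 addr0.
Qed.

Lemma cycle1_0 : cycle1 A (0 : chain R T 1).
Proof. by split; [exact: chain_in0 | exact: boundary0]. Qed.

Lemma cycle1B z w : cycle1 A z -> cycle1 A w -> cycle1 A (z - w).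
Proof.
move=> [zA z0] [wA w0]; split; first exact: chain_inB.
by rewrite boundaryB z0 w0 subrr.
Qed.

Lemma H1_isoD z w : cycle1 A z -> cycle1 A w -> phi (z + w) = phi z + phi w.
Proof. by case: phi_iso => + _ _; apply. Qed.

Lemma H1_iso0 : phi 0 = 0.
Proof. by have := H1_isoD cycle1_0 cycle1_0; rewrite addr0; lia. Qed.

Lemma H1_iso_homologous z w : cycle1 A z -> cycle1 A w -> homologous A z w ->
  phi z = phi w.
Proof.
move=> cz cw zw; rewrite -[z](subrK w) H1_isoD //; last exact: cycle1B.
by case: phi_iso => _ /(_ _ (cycle1B cz cw)) [_ ->] // _; rewrite add0r.
Qed.

Lemma cycle1_sum (I : Type) (r : seq I) (F : I -> chain R T 1) :
  (forall i, cycle1 A (F i)) -> cycle1 A (\sum_(i <- r) F i).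
Proof. by move=> cF; apply: big_ind => //; [exact: cycle1_0 | exact: cycle1D]. Qed.

Lemma H1_iso_sum (I : Type) (r : seq I) (F : I -> chain R T 1) :
  (forall i, cycle1 A (F i)) -> phi (\sum_(i <- r) F i) = \sum_(i <- r) phi (F i).
Proof.
move=> cF; elim: r => [|i r IH]; first by rewrite !big_nil H1_iso0.
by rewrite !big_cons H1_isoD ?IH //; exact: cycle1_sum.
Qed.

End Class.

End Chains.

(** * Walks as singular chains *)

Section Walks.
Context (R : realType) (n : nat).
Local Open Scope classical_set_scope.

(** [walk] is parametrized by the 1-simplex and affine simplices need a path on
    the whole line, so the parameter is first retracted to [[0, 1]]. *)
Definition clamp (t : R) : R := Num.max 0 (Num.min 1 t).

Lemma clamp_itv t : 0 <= clamp t <= 1.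
Proof. by rewrite le_max lexx /= ge_max ler01 ge_min lexx. Qed.

Lemma clamp_id t : 0 <= t <= 1 -> clamp t = t.
Proof. by move=> /andP[t0 t1]; rewrite /clamp min_r // max_r. Qed.

Lemma clamp_continuous : continuous clamp.
Proof.
move=> t; have cc a : {for t, continuous (fun=> a : R^o)} by exact: cvg_cst.
have cm := @continuous_min R R (fun=> 1) id t (cc 1) cvg_id.
exact: (@continuous_max R R (fun=> 0) _ t (cc 0) cm).
Qed.

Definition interval_vec (t : R) : 'rV[R]_2 :=
  (1 - clamp t) *: delta_mx 0 ord0 + clamp t *: delta_mx 0 ord_max.

Lemma interval_vec_simplex t : interval_vec t \in @simplex_set R 2.
Proof.
by apply/mem_set; have [] := edge_in_complete ord0 (ord_max : 'I_2) (clamp_itv t).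
Qed.

Definition interval_point (t : R) : simplex R 2 :=
  exist _ (interval_vec t) (interval_vec_simplex t).

Lemma interval_pointE t : 0 <= t <= 1 ->
  val (interval_point t) ord0 ord_max = t.
Proof.
by move=> t01; rewrite /= /interval_vec clamp_id // !mxE /= mulr0 mulr1 add0r.
Qed.

Lemma interval_point_continuous : continuous interval_point.
Proof.
apply: continuous_comp_initial => t.
have ct := clamp_continuous (x := t).
apply: cvgD; apply: cvgZr_tmp => //.
by apply: cvgB => //; exact: cvg_cst.
Qed.

Lemma walk_fun_continuous (x : 'I_n) s : continuous (@walk_fun R n x s).
Proof.
apply: continuous_big => [|k _ t]; first exact: add_continuous.
apply: cvgZr_tmp.
have zc : {for t, continuous (fun=> 0 : R^o)} by exact: cvg_cst.
have hc : {for t, continuous (fun t : R => 1 - `|(size s)%:R * t - k%:R| : R^o)}.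
  apply: cvgB; first exact: cvg_cst.
  apply: cvg_norm; apply: cvgB; last exact: cvg_cst.
  by apply: cvgMl_tmp; exact: cvg_id.
exact: (@continuous_max R R (fun=> 0) _ t zc hc).
Qed.

Lemma walk_continuous (x : 'I_n) s : continuous (@walk R n x s).
Proof.
apply: continuous_comp_initial => u.
apply: (@continuous_comp _ _ _ (fun u : simplex R 2 => val u ord0 ord_max)); last first.
  exact: walk_fun_continuous.
exact: simplex_coord_continuous.
Qed.

Definition walk_path (x : 'I_n) s (t : R) := walk x s (interval_point t).

Lemma walk_path_continuous (x : 'I_n) s : continuous (walk_path x s).
Proof.
move=> t; apply: continuous_comp; first exact: interval_point_continuous.
exact: walk_continuous.
Qed.

Lemma simplex2E (u : simplex R 2) :
  0 <= val u ord0 ord_max <= 1 /\ val u ord0 ord0 = 1 - val u ord0 ord_max.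
Proof.
have /set_mem[u0 u1] := valP u; move: u1 (u0 ord0) (u0 ord_max).
rewrite !big_ord_recl big_ord0 addr0 (_ : fintype.lift _ _ = ord_max).
  by move=> *; split; [apply/andP; split|]; lra.
exact: val_inj.
Qed.

Lemma walk_fun_edge (x : 'I_n) s j (t : R) : (j < size s)%N ->
  0 <= (size s)%:R * t - j%:R <= 1 ->
  walk_fun x s t =
    (1 - ((size s)%:R * t - j%:R)) *: delta_mx 0 (nth x (x :: s) j) +
    ((size s)%:R * t - j%:R) *: delta_mx 0 (nth x (x :: s) j.+1).
Proof. exact: (hat_sum (fun k => delta_mx 0 (nth x (x :: s) k))). Qed.

Lemma val_walk_edge (x y : 'I_n) u :
  val (@walk R n x [:: y] u) =
    val u ord0 ord0 *: delta_mx 0 x + val u ord0 ord_max *: delta_mx 0 y.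
Proof.
have [u1 u0] := simplex2E u.
by rewrite /= (@walk_fun_edge _ _ 0) //= mul1r subr0 ?u0.
Qed.

Lemma val_walk_path (x : 'I_n) s j (t : R) : (j < size s)%N -> 0 <= t <= 1 ->
  0 <= (size s)%:R * t - j%:R <= 1 ->
  val (walk_path x s t) =
    (1 - ((size s)%:R * t - j%:R)) *: delta_mx 0 (nth x (x :: s) j) +
    ((size s)%:R * t - j%:R) *: delta_mx 0 (nth x (x :: s) j.+1).
Proof.
by move=> js t01 tj; rewrite -(walk_fun_edge x js tj) /= interval_pointE.
Qed.

Lemma affine2E (T : topologicalType) (P : R -> T) a b (u : simplex R 2) :
  affine_simplex P [:: a; b] u =
  P (a + val u ord0 ord_max * (b - a)).
Proof.
have [_ u0] := simplex2E u; rewrite /affine_simplex; congr P.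
rewrite !big_ord_recl big_ord0 addr0 /= (_ : fintype.lift _ _ = ord_max).
  by rewrite u0; ring.
exact: val_inj.
Qed.

(** At constant speed, the [j]th piece of a walk of [m] steps is, on the nose,
    the walk along its [j]th edge. *)
Lemma walk_piece (x : 'I_n) s j : (j < size s)%N ->
  affine_simplex (walk_path x s) [:: j%:R / (size s)%:R; j.+1%:R / (size s)%:R] =
  walk (nth x (x :: s) j) [:: nth x (x :: s) j.+1].
Proof.
move=> js; apply/funext => u; apply: val_inj; rewrite affine2E val_walk_edge.
have [/andP[u0 u1] ->] := simplex2E u; set a := val u _ _ in u0 u1 *.
have m0 : 0 < (size s)%:R :> R by rewrite ltr0n (leq_ltn_trans _ js).
set t := (_ / _ + a * _).
have tE : (size s)%:R * t - j%:R = a.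
  by rewrite /t -natr1; field; rewrite gt_eqF.
have mt : (size s)%:R * t = j%:R + a by rewrite -tE; ring.
have jm : (j.+1%:R : R) <= (size s)%:R by rewrite ler_nat.
have t01 : 0 <= t <= 1.
  apply/andP; split; first by rewrite -(pmulr_rge0 _ m0) mt addr_ge0.
  by rewrite -(ler_pM2l m0) mt mulr1; apply: le_trans jm; rewrite -natr1 lerD2l.
by rewrite (val_walk_path x js t01) tE ?u0.
Qed.

Lemma walk_whole (x : 'I_n) s : affine_simplex (walk_path x s) [:: 0; 1] = walk x s.
Proof.
apply/funext => u; rewrite affine2E subr0 mulr1 add0r; apply: val_inj => /=.
by have [u1 _] := simplex2E u; rewrite interval_pointE.
Qed.

Lemma walk_reversed_edge (x y : 'I_n) :
  affine_simplex (walk_path x [:: y]) [:: 1; 0] = walk y [:: x].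
Proof.
apply/funext => u; apply: val_inj; rewrite affine2E val_walk_edge.
have [/andP[u0 u1] ->] := simplex2E u; set a := val u _ _ in u0 u1 *.
rewrite (@val_walk_path _ _ 0) //=; [|apply/andP; split; lra..].
by rewrite addrC; congr (_ *: _ + _ *: _); ring.
Qed.

Definition vertex (x : 'I_n) : complete_space R n := walk_path x [:: x] 0.

Lemma val_vertex x : val (vertex x) = delta_mx 0 x.
Proof.
rewrite (@val_walk_path _ _ 0) //= ?mulr0 ?subr0 ?lexx ?ler01 //.
by rewrite scale1r scale0r addr0.
Qed.

Lemma walk_start (x : 'I_n) s : (0 < size s)%N -> walk_path x s 0 = vertex x.
Proof.
move=> s0; apply: val_inj; rewrite val_vertex.
rewrite (@val_walk_path _ _ 0) //= ?mulr0 ?subr0 ?lexx ?ler01 //.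
by rewrite scale1r scale0r addr0.
Qed.

Lemma walk_end (x : 'I_n) s : (0 < size s)%N -> walk_path x s 1 = vertex (last x s).
Proof.
move=> s0; apply: val_inj; rewrite val_vertex.
have sE : (size s)%:R * 1 - (size s).-1%:R = 1 :> R.
  by rewrite mulr1 -{1}(prednK s0) -natr1; ring.
rewrite (@val_walk_path _ _ (size s).-1) ?prednK ?sE ?lexx ?ler01 //.
by rewrite subrr scale0r add0r scale1r nth_last.
Qed.

(** * Linking numbers as edge sums *)

Section Potential.
Context (T : topologicalType) (g : complete_space R n -> T) (gc : continuous g).
Context (A : set T) (gA : range g `<=` A).

Definition point_chain (x : 'I_n) : chain R T 0 :=
  << fun _ : simplex R 1 => g (vertex x) >>.

Definition walk_chain (x : 'I_n) s : chain R T 1 := << g \o walk x s >>.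

Let path_continuous (x : 'I_n) s : continuous (g \o walk_path x s).
Proof.
by move=> t; apply: continuous_comp; [exact: walk_path_continuous | exact: gc].
Qed.

Let path_range (x : 'I_n) s : range (g \o walk_path x s) `<=` A.
Proof. by move=> _ [t _ <-]; apply: gA; exists (walk_path x s t). Qed.

Lemma walk_chainE x s : walk_chain x s = segment (g \o walk_path x s) 0 1.
Proof. by rewrite /walk_chain -walk_whole. Qed.

Lemma walk_chain_in x s : chain_in A (walk_chain x s).
Proof. by rewrite walk_chainE; exact: affine_simplex_chain_in. Qed.

Lemma affine1E (P : R -> T) a :
  @affine_simplex R T P 1 [:: a] = fun=> P a.
Proof.
apply/funext => u; have /set_mem[_] := valP u; rewrite /affine_simplex.
by rewrite !big_ord_recl !big_ord0 !addr0 => -> /=; rewrite mul1r.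
Qed.

Lemma boundary_walk x s : (0 < size s)%N ->
  boundary (walk_chain x s) = point_chain (last x s) - point_chain x.
Proof.
move=> s0; rewrite walk_chainE boundary_segment !affine1E /=.
by rewrite walk_start // walk_end.
Qed.

(** Running along an edge and back is the degenerate triangle [0, 1, 0]. *)
Lemma edge_reverse x y :
  homologous A (walk_chain x [:: y] + walk_chain y [:: x]) 0.
Proof.
have pc := @path_continuous x [:: y]; have pr := @path_range x [:: y].
have := homologous_trans (segment_split pc pr 0 1 0) (segment_point pc pr 0).
rewrite -walk_chainE [segment _ 1 0](_ : _ = walk_chain y [:: x]) //.
by rewrite /walk_chain -walk_reversed_edge.
Qed.

Lemma walk_edges x s : (0 < size s)%N ->
  homologous A
    (\sum_(k < size s) walk_chain (nth x (x :: s) k) [:: nth x (x :: s) k.+1])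
    (walk_chain x s).
Proof.
move=> s0; have pc := @path_continuous x s; have pr := @path_range x s.
have := segment_sum pc pr (fun k => k%:R / (size s)%:R) (size s).
rewrite mul0r divff ?pnatr_eq0 -?lt0n // -walk_chainE.
congr (homologous A _ _); apply: eq_bigr => k _.
by rewrite /walk_chain -walk_piece.
Qed.

Context (phi : chain R T 1 -> int) (phi_iso : H1_iso_int A phi) (x0 : 'I_n).

(** The third side is subtracted instead of being traversed from [y] to [x0];
    in this way the spokes cancel as chains in a sum along a closed walk. *)
Definition triangle x y : chain R T 1 :=
  walk_chain x0 [:: x] + walk_chain x [:: y] - walk_chain x0 [:: y].

Lemma triangle_cycle1 x y : cycle1 A (triangle x y).
Proof.
split; first by apply: chain_inB; [apply: chain_inD|]; exact: walk_chain_in.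
by rewrite boundaryB boundaryD !boundary_walk //= [X in X - _]addrC addrA subrK subrr.
Qed.

Lemma triangle_classC x y : phi (triangle x y) = - phi (triangle y x).
Proof.
apply/eqP; rewrite -addr_eq0 -(H1_isoD phi_iso); [|exact: triangle_cycle1..].
rewrite -(H1_iso0 phi_iso); apply/eqP; apply: (H1_iso_homologous phi_iso).
- by apply: cycle1D; exact: triangle_cycle1.
- exact: cycle1_0.
rewrite /triangle [walk_chain x0 [:: x] + _]addrC [walk_chain x0 [:: y] + _]addrC.
rewrite -[_ - walk_chain x0 [:: y]]addrA -[_ - walk_chain x0 [:: x]]addrA addrACA.
rewrite -[walk_chain x0 [:: y] - _]opprB subrr addr0.
exact: edge_reverse.
Qed.

Lemma class_closed_walk x s : uniq (x :: s) ->
  phi (walk_chain x (rcons s x)) =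
    cycle_sum (fun y z => phi (triangle y z)) (x :: s).
Proof.
move=> Uxs; set c := nth x (x :: rcons s x).
have -> : phi (walk_chain x (rcons s x)) =
    phi (\sum_(k < size (rcons s x)) triangle (c k) (c k.+1)).
  apply: (H1_iso_homologous phi_iso).
  - split; first exact: walk_chain_in.
    by rewrite boundary_walk ?size_rcons // last_rcons subrr.
  - by apply: cycle1_sum => k; exact: triangle_cycle1.
  have : (0 < size (rcons s x))%N by rewrite size_rcons.
  move=> /(walk_edges x) [v vA vE]; exists (- v).
    by rewrite -sub0r; apply: chain_inB => //; exact: chain_in0.
  rewrite -[in LHS]sub0r boundaryB boundary0 sub0r vE opprB; congr (_ - _).
  (* The sum of the spokes telescopes, and the walk ends where it starts. *)
  rewrite -[LHS]addr0; under [RHS]eq_bigr do rewrite /triangle addrAC.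
  rewrite big_split /= addrC; congr (_ + _).
  pose spoke k := walk_chain x0 [:: c k].
  rewrite -(big_mkord xpredT (fun k => spoke k - spoke k.+1)) {}/spoke.
  rewrite -[RHS]opprK -sumrN; under [in RHS]eq_bigr do rewrite opprB.
  rewrite telescope_sumr // /c size_rcons /= nth_rcons ltnn eqxx subrr oppr0.
  by [].
rewrite (H1_iso_sum phi_iso) => [|k]; last exact: triangle_cycle1.
rewrite /cycle_sum (big_nth x) big_mkord size_rcons; apply: eq_bigr => k _.
have kc : nth x (x :: s) k = c k by rewrite /c -rcons_cons nth_rcons ltn_ord.
rewrite kc; congr (phi (triangle _ _)).
rewrite -kc next_nth mem_nth // index_uniq // /c /= nth_rcons.
case: ltngtP => // sk; first by rewrite nth_default // ltnW.
by rewrite nth_default // sk.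
Qed.

End Potential.

End Walks.

(** * The identity *)

Lemma orientation_traverses n c (g : {set {set 'I_n}}) :
  traverses c g -> traverses (orientation g) g.
Proof. by move=> tc; rewrite /orientation; case: xgetP => [d _ //|/(_ c)[]]. Qed.

Theorem lemma2p2 (R : realType) (n : nat) (n_ge4 : (4 <= n)%N)
    (f : loop_complete R n -> sphere R 3) (f_embedding : embedding f) :
  \sum_(g in Gamma n n) lk f g ^+ 2 = \sum_(g in Gamma n.-1 n) lk f g ^+ 2.
Proof.
have [f_inj f_open] := f_embedding.
set K := range (f \o @in_loop R n).
have [[psi psi_iso]|no_iso] :=
    pselect (exists phi, @H1_iso_int R _ (~` K)%classic phi); last first.
  (* Without such an isomorphism every linking number is the default [0]. *)
  have lk0 g : lk f g = 0.
    rewrite /lk; case: (orientation g) => // x s; rewrite /linking_number -/K.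
    by case: xgetP => // phi _ phi_iso; case: no_iso; exists phi.
  by rewrite !big1 // => g _; rewrite lk0 expr0n.
set phi := xget (fun=> 0) [set phi | @H1_iso_int R _ (~` K) phi]%classic.
have phi_iso : H1_iso_int (~` K)%classic phi.
  by apply: (@xgetPex _ (fun=> 0) [set phi | H1_iso_int (~` K) phi]%classic); exists psi.
have x0 : 'I_n by exact: Ordinal n_ge4.
pose h := f \o @in_complete R n.
have hc : continuous h.
  have fc : continuous f.
    by apply/continuousP => V oV; apply/f_open; exists V.
  move=> x; apply: continuous_comp; last exact: fc.
  exact: existT_continuous.
have hK : (range h `<=` ~` K)%classic.
  by move=> _ [x _ <-] [y _ /f_inj].
apply: (sum_Gamma_eq n_ge4 (triangle_classC hc hK phi_iso x0)) => c g tc.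
have to := orientation_traverses tc.
rewrite (cycle_sum_traverses (triangle_classC hc hK phi_iso x0) to tc).
rewrite /lk; case: (orientation g) to => [/traversesP[]//|x s /traversesP[_ Uxs _]].
by rewrite -(class_closed_walk hc hK phi_iso).
Qed.
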